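(* Let $k$ be a positive even integer, let $m\in\mathbb{N}$, $m\ge 1$, and put $i=\frac{m}{2}$. Let $q$ be a complex number with $0<|q|<1$, and define $$S_n(q) := q^{2i-1}\,\frac{\left(q^{\frac{k}{4}-(4i-2)},\,q^{\frac{3k}{4}+(4i-2)};\,q^{k}\right)_\infty}{\left(q^{\frac{k}{4}+(4i-2)},\,q^{\frac{3k}{4}-(4i-2)};\,q^{k}\right)_\infty}=q^{2i-1}\,\frac{f\left(-q^{\frac{k}{4}-(4i-2)},-q^{\frac{3k}{4}+(4i-2)}\right)}{f\left(-q^{\frac{k}{4}+(4i-2)},-q^{\frac{3k}{4}-(4i-2)}\right)},$$ where it is assumed that the numerator and the denominator of this quotient are nonzero. Then $$\frac{1}{S_n(q)}-S_n(q)=\frac{\phi\left(q^{\frac{k}{4}}\right) f\left(-q^{4i-2},-q^{\frac{k}{2}-(4i-2)}\right)}{q^{2i-1}\,\psi\left(q^{\frac{k}{2}}\right) f\left(-q^{\frac{k}{4}-(4i-2)},-q^{\frac{k}{4}+(4i-2)}\right)}$$ and $$\frac{1}{S_n(q)}+S_n(q)=\frac{\phi\left(-q^{\frac{k}{4}}\right) f\left(q^{4i-2},q^{\frac{k}{2}-(4i-2)}\right)}{q^{2i-1}\,\psi\left(q^{\frac{k}{2}}\right) f\left(-q^{\frac{k}{4}-(4i-2)},-q^{\frac{k}{4}+(4i-2)}\right)}.$$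
   Context: For complex $\lambda$ and $|q|<1$, $(\lambda;q)_\infty=\prod_{n\ge 0}(1-\lambda q^n)$ and $(\lambda_1,\dots,\lambda_r;q)_\infty=\prod_{j=1}^r(\lambda_j;q)_\infty$. Ramanujan's general theta function is $f(a,b)=\sum_{n=-\infty}^{\infty}a^{n(n+1)/2}b^{n(n-1)/2}$ for $|ab|<1$; by Jacobi's triple product identity $f(a,b)=(-a;ab)_\infty(-b;ab)_\infty(ab;ab)_\infty$. Special cases: $\phi(q)=f(q,q)=\sum_{n=-\infty}^\infty q^{n^2}$ and $\psi(q)=f(q,q^3)=\sum_{n=0}^\infty q^{n(n+1)/2}$. A fourth root $q^{1/4}$ of $q$ is fixed once and for all, and every power $q^{r/4}$ with $r\in\mathbb{Z}$ means $(q^{1/4})^r$. The subscript $n$ in $S_n$ is only a label; the function depends on $k$ and $i$. *)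

(* Defs.v *)
From HB Require Import structures.
From mathcomp Require Import all_boot all_order all_algebra.
From mathcomp Require Import all_classical all_reals all_analysis.

Set Implicit Arguments.
Unset Strict Implicit.
Unset Printing Implicit Defensive.

Import Order.TTheory GRing.Theory Num.Theory.
Import numFieldNormedType.Exports.

#[global] Open Scope ring_scope.

Section QSeries.
Variable K : numFieldType.
Implicit Types (a b l q : K) (e : rat).

(* The limits below are those of the norm topology of K, here R[i] for a real
   type R; they are meaningful for |q| < 1 (resp. |a b| < 1 in theta). *)
Definition qpoch l q : K := \big[*%R/1]_(0 <= n <oo) (1 - l * q ^+ n).

Definition qpochs (ls : seq K) q : K := \prod_(l <- ls) qpoch l q.

(* The sum over all integers n: Negz n is - (n + 1). *)
Definition bilateral_sum (t : int -> K) : K :=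
  \big[+%R/0]_(0 <= n <oo) t (Posz n) + \big[+%R/0]_(0 <= n <oo) t (Negz n).

(* Ramanujan's f(a, b).  The divisions by 2 are exact and the exponents are
   nonnegative, so the terms also make sense when a or b vanishes. *)
Definition theta a b : K :=
  bilateral_sum
    (fun n : int => a ^ ((n * (n + 1)) %/ 2)%Z * b ^ ((n * (n - 1)) %/ 2)%Z).

Definition phi q : K := theta q q.

Definition psi q : K := theta q (q ^+ 3).

(* q^e computed from the chosen fourth root r of q, as r^(4 e).  Only
   exponents e in (1/4)Z are meaningful, and then the floor is exact. *)
Definition qpow (r : K) e : K := r ^ Num.floor (4 * e).

Lemma qpow_quarter (r : K) (z : int) : qpow r (z%:~R / 4) = r ^ z.
Proof. by rewrite /qpow mulrCA divff // mulr1 intrKfloor. Qed.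

Definition S_num (r : K) (k : nat) (i : rat) : K :=
  qpochs [:: qpow r (k%:R / 4 - (4 * i - 2));
             qpow r (3 * k%:R / 4 + (4 * i - 2))] (qpow r k%:R).

Definition S_den (r : K) (k : nat) (i : rat) : K :=
  qpochs [:: qpow r (k%:R / 4 + (4 * i - 2));
             qpow r (3 * k%:R / 4 - (4 * i - 2))] (qpow r k%:R).

(* The n in the name is a label, not a parameter. *)
Definition Sn (r : K) (k : nat) (i : rat) : K :=
  qpow r (2 * i - 1) * (S_num r k i / S_den r k i).

End QSeries.

(* Main.v *)
(** Write x = q^(k/4), y = q^(4i-2), s = q^(2i-1), so that y = s^2, and let N and
    D be the two products in S = s N / D.  By Jacobi's triple product identity
    f1 = f(-xy, -x^3/y) and f2 = f(-x/y, -x^3 y) are D and N times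
    (x^4; x^4), so 1/S -+ S is (f1^2 -+ y f2^2) / (s f1 f2).  Expanding the
    squares into double series over the pairs (n, m) and substituting u = n + m,
    v = n - m in f1^2 and u = 1 - (n + m), v = n - m in y f2^2, the first one
    provides the terms with u and v of equal parity, and the second one those
    with u and v of opposite parity, of the double series of
    phi(+-x) f(-+y, -+x^2/y).  The denominator is identified by
    psi(x^2) (x^2; x^2) = (x^4; x^4)^2.

    The triple product identity is the limit, by Tannery's theorem, of the Gauss
    binomial theorem. *)

Require Import Defs.
From mathcomp Require Import all_boot all_order all_algebra.
From mathcomp Require Import all_classical all_reals all_analysis.
From mathcomp Require Import complex ring zify.

Set Implicit Arguments.
Unset Strict Implicit.
Unset Printing Implicit Defensive.

Import Order.TTheory GRing.Theory Num.Theory.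
Import numFieldNormedType.Exports.

(** * Unconditional summation *)

Section UnconditionalSums.
Variable K : numFieldType.

(** Convergence along the net of finite subsets, encoded as duplicate-free lists. No enumeration of
    the index type is involved, so bijective reindexing and passage to double series cost
    nothing. *)
Definition has_sum (I : eqType) (F : I -> K) (s : K) :=
  forall e, 0 < e -> exists A : seq I, forall B, uniq B -> {subset A <= B} ->
    `|s - \sum_(i <- B) F i| < e.

Lemma subset_undup_catl (I : eqType) (A B : seq I) :
  {subset A <= undup (A ++ B)}.
Proof. by move=> i iA; rewrite mem_undup mem_cat iA. Qed.

Lemma subset_undup_catr (I : eqType) (A B : seq I) :
  {subset B <= undup (A ++ B)}.
Proof. by move=> i iB; rewrite mem_undup mem_cat iB orbT. Qed.

Lemma has_sum_unique (I : eqType) (F : I -> K) s t :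
  has_sum F s -> has_sum F t -> s = t.
Proof.
move=> Fs Ft; apply/eqP; rewrite -subr_eq0 -normr_eq0; apply/negPn/negP => st_neq0.
have e_gt0 : 0 < `|s - t| / 2 by rewrite divr_gt0 // lt0r st_neq0 /=.
have [A As] := Fs _ e_gt0; have [B Bt] := Ft _ e_gt0.
have := ltrD (As _ (undup_uniq (A ++ B)) _) (Bt _ (undup_uniq (A ++ B)) _).
rewrite -splitr [`|t - _|]distrC; set S := \sum_(i <- _) _.
have -> : s - t = (s - S) + (S - t) by rewrite addrA subrK.
move=> /(_ (@subset_undup_catl _ _ _) (@subset_undup_catr _ _ _)).
by move=> lt; have := le_lt_trans (ler_normD _ _) lt; rewrite ltxx.
Qed.

Lemma has_sum_reindex (I J : eqType) (h : I -> J) (h' : J -> I) (F : J -> K) s :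
  cancel h h' -> cancel h' h -> has_sum (F \o h) s -> has_sum F s.
Proof.
move=> hK h'K Fs e e_gt0; have [A As] := Fs e e_gt0; exists (map h A) => B uB AB.
have -> : \sum_(j <- B) F j = \sum_(i <- map h' B) F (h i).
  by rewrite big_map; apply: eq_bigr => j _; rewrite h'K.
apply: As; first by rewrite map_inj_uniq //; exact: can_inj h'K.
move=> i iA; apply/mapP; exists (h i); last by rewrite hK.
by apply: AB; apply: map_f.
Qed.

Lemma eq_has_sum (I : eqType) (F G : I -> K) s :
  F =1 G -> has_sum F s -> has_sum G s.
Proof.
move=> FG Fs e /Fs [A As]; exists A => B uB AB.
by rewrite -(eq_bigr _ (fun i _ => FG i)); exact: As.
Qed.

Lemma has_sumZ (I : eqType) (F : I -> K) s c :
  has_sum F s -> has_sum (fun i => c * F i) (c * s).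
Proof.
move=> Fs e e_gt0; have d_gt0 : 0 < e / (`|c| + 1).
  by rewrite divr_gt0 // ltr_wpDl.
have [A As] := Fs _ d_gt0; exists A => B uB AB.
rewrite -mulr_sumr -mulrBr normrM; have := As B uB AB.
rewrite ltr_pdivlMr ?ltr_wpDl // mulrC; apply: le_lt_trans.
by rewrite ler_wpM2r // lerDl.
Qed.

Lemma has_sum_sum (I J : eqType) (F : I + J -> K) s t :
  has_sum (fun i => F (inl i)) s -> has_sum (fun j => F (inr j)) t ->
  has_sum F (s + t).
Proof.
move=> Fs Ft e e_gt0; have e2_gt0 : 0 < e / 2 by rewrite divr_gt0.
have [A As] := Fs _ e2_gt0; have [B Bt] := Ft _ e2_gt0.
exists (map inl A ++ map inr B) => C uC ABC.
(* A finite list over the disjoint union is split into its two sides, each of which contains the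
   corresponding approximating list. *)
pose getl (x : I + J) := if x is inl i then Some i else None.
pose getr (x : I + J) := if x is inr j then Some j else None.
have -> : \sum_(x <- C) F x =
    \sum_(i <- pmap getl C) F (inl i) + \sum_(j <- pmap getr C) F (inr j).
  elim: C {uC ABC} => [|[i|j] C IHC]; rewrite ?big_nil ?addr0 //= !big_cons IHC.
    by rewrite addrA.
  by rewrite addrCA.
rewrite opprD addrACA (splitr e); apply: le_lt_trans (ler_normD _ _) _.
apply: ltrD.
  apply: As.
    apply: (pmap_uniq (g := inl)) uC; by case.
  move=> i iA; rewrite mem_pmap; apply/mapP; exists (inl i) => //.
  by apply: ABC; rewrite mem_cat map_f.
apply: Bt.
  apply: (pmap_uniq (g := inr)) uC; by case.
move=> i iA; rewrite mem_pmap; apply/mapP; exists (inr i) => //.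
by apply: ABC; rewrite mem_cat [X in _ || X]map_f ?orbT.
Qed.

Lemma uniq_subset_sum (I : eqType) (F : I -> K) (A B : seq I) :
  uniq A -> uniq B -> {subset A <= B} ->
  \sum_(i <- B) F i = \sum_(i <- A) F i + \sum_(i <- B | i \notin A) F i.
Proof.
move=> uA uB AB; rewrite (bigID (mem A)) /=; congr (_ + _).
rewrite -big_filter; apply: perm_big; apply: uniq_perm => //.
  exact: filter_uniq.
move=> i; rewrite mem_filter; case: (boolP (i \in A)) => //= /AB -> //.
Qed.

(** The partial sums equal their own norms, so by the reverse triangle inequality they also
    approximate [|S|]; uniqueness then gives [S = |S|]. *)
Lemma has_sum_ge0 (I : eqType) (F : I -> K) S :
  (forall i, 0 <= F i) -> has_sum F S -> 0 <= S.
Proof.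
move=> F_ge0 FS; suff /(has_sum_unique FS) -> : has_sum F `|S| by [].
move=> e /FS [A AS]; exists A => B uB AB; apply: le_lt_trans (AS B uB AB).
by rewrite -[X in `| _ - X|]ger0_norm ?sumr_ge0 // ler_dist_dist.
Qed.

Lemma has_sum_le (I : eqType) (F : I -> K) S (A : seq I) :
  (forall i, 0 <= F i) -> has_sum F S -> uniq A -> \sum_(i <- A) F i <= S.
Proof.
move=> F_ge0 FS uA; have S_ge0 := has_sum_ge0 F_ge0 FS.
have sum_ge0 (B : seq I) P : 0 <= \sum_(i <- B | P i) F i by apply: sumr_ge0.
(* The order of [K] is only partial: negating the inequality requires both sides to be real. A sum
   exceeding [S] by e would stay above [S + e] on every larger list. *)
rewrite real_leNgt ?ger0_real //; apply/negP; rewrite -subr_gt0 => e_gt0.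
have [B BS] := FS _ e_gt0.
have := BS (undup (A ++ B)) (undup_uniq _).
have sA := @subset_undup_catl _ A B; have sB := @subset_undup_catr _ A B.
move=> /(_ sB); rewrite (uniq_subset_sum F uA (undup_uniq _) sA).
set X := \sum_(i <- A) _; set Y := \sum_(i <- _ | _) _.
rewrite distrC => /(le_lt_trans (real_ler_norm _)).
have -> : X + Y - S = (X - S) + Y by rewrite addrAC.
have -> : X - S + Y \is Num.real by rewrite realD ?realB ?ger0_real ?sum_ge0.
by move=> /(_ isT); rewrite gtrDl le_gtF ?sum_ge0.
Qed.

(* Outside A x B, every finite part of the family |F i| |G j| has sum at most
   S T minus the sum over A x B, which is small for large A and B. *)
Lemma has_sum_mul (I J : eqType) (F : I -> K) (G : J -> K) s t S T :
  has_sum F s -> has_sum G t ->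
  has_sum (fun i => `|F i|) S ->
  has_sum (fun j => `|G j|) T ->
  has_sum (fun x : I * J => F x.1 * G x.2) (s * t).
Proof.
move=> Fs Gt FS GT e e_gt0.
have S_le A := has_sum_le (A := A) (fun=> normr_ge0 _) FS.
have T_le B := has_sum_le (A := B) (fun=> normr_ge0 _) GT.
have S_ge0 : 0 <= S by apply: has_sum_ge0 FS.
have T_ge0 : 0 <= T by apply: has_sum_ge0 GT.
(* [M] collects the coefficients of d in the final estimate; the last summand 1 makes [M] positive
   and the estimate strict. *)
set M := `|t| + S + (T + S) + 1.
have M_gt0 : 0 < M by rewrite ltr_wpDl // !addr_ge0.
set d := e / M; have d_gt0 : 0 < d by rewrite divr_gt0.
have [A1 A1s] := Fs _ d_gt0; have [A2 A2S] := FS _ d_gt0.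
have [B1 B1t] := Gt _ d_gt0; have [B2 B2T] := GT _ d_gt0.
pose A := undup (A1 ++ A2); pose B := undup (B1 ++ B2).
have uA : uniq A := undup_uniq _; have uB : uniq B := undup_uniq _.
have {A1s} As := A1s _ uA (@subset_undup_catl _ _ _).
have {A2S} AS := A2S _ uA (@subset_undup_catr _ _ _).
have {B1t} Bt := B1t _ uB (@subset_undup_catl _ _ _).
have {B2T} BT := B2T _ uB (@subset_undup_catr _ _ _).
pose AB := [seq (i, j) | i <- A, j <- B].
have pair_uniq (C : seq I) (D : seq J) :
    uniq C -> uniq D -> uniq [seq (i, j) | i <- C, j <- D].
  by move=> uC uD; apply: allpairs_uniq => // -[? ?] [? ?].
have sum_pair (f : I -> K) (g : J -> K) (C : seq I) (D : seq J) :
    \sum_(x <- [seq (i, j) | i <- C, j <- D]) f x.1 * g x.2 =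
    (\sum_(i <- C) f i) * (\sum_(j <- D) g j).
  by rewrite big_allpairs /= mulr_suml; apply: eq_bigr => i _; rewrite mulr_sumr.
have uAB : uniq AB by apply: pair_uniq.
exists AB => E uE ABE.
(* [E] need not be a rectangle, but it lies in the product of its two projections, over which the
   sum of norms factors and is at most [S * T]. *)
have sub_E : {subset E <= [seq (i, j) | i <- undup (map fst E), j <- undup (map snd E)]}.
  move=> [i j] ijE; apply/allpairsP; exists (i, j); split => //;
    by rewrite mem_undup; apply/mapP; exists (i, j).
have := uniq_subset_sum (fun x => `|F x.1| * `|G x.2|) uE _ sub_E.
move=> /(_ (pair_uniq _ _ (undup_uniq _) (undup_uniq _))).
pose nF i := `|F i|; pose nG j := `|G j|.
rewrite (sum_pair nF nG) (uniq_subset_sum _ uAB uE ABE) (sum_pair nF nG).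
rewrite (uniq_subset_sum (fun x => F x.1 * G x.2) uAB uE ABE) (sum_pair F G).
set F0 := \sum_(i <- A) F i; set G0 := \sum_(j <- B) G j.
set X0 := \sum_(i <- A) nF i; set Y0 := \sum_(j <- B) nG j.
set X1 := \sum_(i <- undup _) nF i; set Y1 := \sum_(j <- undup _) nG j.
set rest := \sum_(x <- E | _) _; set rest' := \sum_(x <- _ | _) _ => XY1.
have rest'_ge0 : 0 <= rest' by apply: sumr_ge0 => x _; rewrite mulr_ge0.
have Y1_ge0 : 0 <= Y1 by apply: sumr_ge0 => j _; apply: normr_ge0.
have X1_ge0 : 0 <= X1 by apply: sumr_ge0 => i _; apply: normr_ge0.
have X0_le : X0 <= S := S_le _ uA.
have Y0_le : Y0 <= T := T_le _ uB.
have rest_le : rest <= S * T - X0 * Y0.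
  rewrite lerBrDl; apply: le_trans (_ : X1 * Y1 <= _).
    by rewrite XY1 lerDl.
  by rewrite ler_pM // ?S_le ?T_le ?undup_uniq.
set r := \sum_(x <- E | _) F x.1 * G x.2.
have r_le : `|r| <= S * T - X0 * Y0.
  apply: le_trans rest_le; apply: le_trans (ler_norm_sum _ _ _) _.
  by apply: ler_sum => x _; rewrite normrM.
have F0_le : `|F0| <= S by apply: le_trans (ler_norm_sum _ _ _) X0_le.
have -> : s * t - (F0 * G0 + r) = (s - F0) * t + F0 * (t - G0) - r by ring.
have -> : e = d * `|t| + S * d + (d * T + S * d) + d.
  have -> : e = d * M by rewrite /d divfK // gt_eqF.
  by rewrite /M; ring.
apply: le_lt_trans (ler_normB _ _) _; 
apply: (@le_lt_trans _ _ (d * `|t| + S * d + (d * T + S * d))); last by rewrite ltrDl.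
apply: lerD.
  apply: le_trans (ler_normD _ _) _; rewrite !normrM.
  by rewrite lerD // ?ler_wpM2r ?ler_pM // ltW.
apply: le_trans r_le _.
have -> : S * T - X0 * Y0 = (S - X0) * T + X0 * (T - Y0) by ring.
have SX : S - X0 <= d by rewrite ltW // -[S - _]ger0_norm ?subr_ge0.
have TY : T - Y0 <= d by rewrite ltW // -[T - _]ger0_norm ?subr_ge0.
by rewrite lerD // ?ler_wpM2r // ler_pM ?subr_ge0 // sumr_ge0 // => i _; apply: normr_ge0.
Qed.
End UnconditionalSums.

(** * Absolutely convergent series and infinite products *)

Section AbsolutelySummable.
Local Open Scope classical_set_scope.

Definition abs_summable (K : numFieldType) (u : nat -> K) :=
  exists M : K, forall n, \sum_(0 <= i < n) `|u i| <= M.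

(** The only form of completeness needed. Keeping it as a hypothesis lets the analysis be done over
    any [numFieldType]; it is discharged at the end for [R[i]]. *)
Definition series_complete (K : numFieldType) :=
  forall u : nat -> K, abs_summable u -> cvgn (fun n => \sum_(0 <= i < n) u i).

Lemma cvg_real_complex (R : realType) (K := R[i] : numFieldType)
    (f : nat -> R) (l : R) :
  f @ \oo --> l -> (fun n => real_complex R (f n) : K) @ \oo --> (real_complex R l : K).
Proof.
move=> /cvgrPdist_lt fl; apply/cvgrPdist_lt => e e_gt0.
have eE : e = real_complex R (complex.Re e) by rewrite RRe_real // ger0_real ?ltW.
have : 0 < complex.Re e by rewrite -ltcR -eE.
move=> /fl; apply: filterS => n; rewrite eE -rmorphB /= normc_def /= expr0n addr0.
by rewrite sqrtr_sqr ltcR.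
Qed.

(** Real and imaginary parts are dominated by the norm, so each gives an absolutely convergent real
    series. *)
Lemma complex_series_complete (R : realType) : series_complete R[i].
Proof.
move=> u [M uM]; have part (f : R[i] -> R) :
    (forall x, real_complex R `|f x| <= `|x|) -> cvgn (series (fun n => f (u n))).
  move=> f_le; apply: normed_cvg; apply: nondecreasing_is_cvgn.
    by apply: nondecreasing_series => i _ _; apply: normr_ge0.
  exists (complex.Re M) => _ [n _ <-].
  have : 0 <= M by have := uM 0%N; rewrite big_nil.
  rewrite -lecR => /ger0_real /RRe_real ->; apply: le_trans (uM n).
  by rewrite /series /= rmorph_sum; apply: ler_sum => i _; apply: f_le.
have /part /cvg_real_complex reu : forall x : R[i], real_complex R `|complex.Re x| <= `|x|.
  by move=> x; rewrite normc_def lecR -sqrtr_sqr ler_wsqrtr // lerDl sqr_ge0.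
have /part /cvg_real_complex imu : forall x : R[i], real_complex R `|complex.Im x| <= `|x|.
  by move=> x; rewrite normc_def lecR -sqrtr_sqr ler_wsqrtr // lerDr sqr_ge0.
apply/cvg_ex; eexists.
have -> : (fun n => \sum_(0 <= i < n) u i) =
  (fun n => real_complex R (series (fun n => complex.Re (u n)) n)
    + Complex 0 1 * real_complex R (series (fun n => complex.Im (u n)) n)).
  apply/funext => n; rewrite /series /= !rmorph_sum mulr_sumr -big_split /=.
  by apply: eq_bigr => i _; rewrite -complexE.
by apply: cvgD reu _; apply: cvgM imu; exact: cvg_cst.
Qed.
End AbsolutelySummable.

(** * Criteria for absolute summability, and unconditional sums of series *)

Section CompleteField.
Local Open Scope classical_set_scope.
Variable K : numFieldType.
Implicit Types u v : nat -> K.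

Lemma abs_summable_norm u : abs_summable u -> abs_summable (fun n => `|u n|).
Proof.
by move=> [M uM]; exists M => n; under eq_bigr do rewrite normr_id.
Qed.

Lemma abs_summableZ (c : K) u : abs_summable u -> abs_summable (fun n => c * u n).
Proof.
move=> [M uM]; exists (`|c| * M) => n.
by under eq_bigr do rewrite normrM; rewrite -mulr_sumr ler_wpM2l.
Qed.

Lemma abs_summable_bounded_mul (B : K) u v :
  (forall n, `|v n| <= B) -> abs_summable u -> abs_summable (fun n => v n * u n).
Proof.
move=> vB [M uM]; have B_ge0 : 0 <= B := le_trans (normr_ge0 _) (vB 0%N).
exists (B * M) => n; apply: (@le_trans _ _ (B * \sum_(0 <= i < n) `|u i|)).
  by rewrite mulr_sumr ler_sum // => i _; rewrite normrM ler_wpM2r.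
by rewrite ler_wpM2l.
Qed.

Lemma abs_summable_geometric (x : K) : `|x| < 1 -> abs_summable (fun n => x ^+ n).
Proof.
move=> x_lt1; have d_gt0 : 0 < 1 - `|x| by rewrite subr_gt0.
exists (1 / (1 - `|x|)) => n; rewrite ler_pdivlMr //.
under eq_bigr do rewrite normrX.
rewrite mulrC big_mkord; have := subrX1 `|x| n.
move=> /(congr1 -%R); rewrite -mulNr !opprB => <-.
by rewrite gerBl exprn_ge0.
Qed.

Lemma abs_summable_ratio u (N : nat) :
  (forall n, (N <= n)%N -> `|u n.+1| <= `|u n| / 2) -> abs_summable u.
Proof.
move=> u_half; exists (\sum_(0 <= i < N) `|u i| + 2 * `|u N|) => n.
have mono m p : (m <= p)%N -> \sum_(0 <= i < m) `|u i| <= \sum_(0 <= i < p) `|u i|.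
  by move=> mp; rewrite [leRHS](big_cat_nat (leq0n m) mp) /= lerDl sumr_ge0.
apply: le_trans (mono n (N + n)%N (leq_addl _ _)) _.
(* The partial sum plus twice the norm of the next term does not increase from index N on, since
   each term is at most half of its predecessor. *)
apply: (@le_trans _ _ (\sum_(0 <= i < N + n) `|u i| + 2 * `|u (N + n)%N|)).
  by rewrite lerDl mulr_ge0.
elim: n => [|n IHn]; first by rewrite addn0.
apply: le_trans IHn; rewrite addnS big_nat_recr //= -addrA lerD2l.
rewrite [2 * `|u (N + n)%N|]mulr_natl mulr2n lerD2l mulrC -ler_pdivlMr //.
by rewrite u_half // leq_addr.
Qed.

Hypothesis complete : series_complete K.

(** Bounded monotone sequences need not converge in a general [K], so completeness is applied to the
    series of norms, whose Cauchy property gives the small tails. *)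
Lemma abs_summable_tail u : abs_summable u -> forall e, 0 < e ->
  exists N, forall n, (N <= n)%N -> \sum_(N <= i < n) `|u i| < e.
Proof.
move=> /abs_summable_norm /complete /cvg_ex [l /cvgrPdist_lt ul] e e_gt0.
have e2_gt0 : 0 < e / 2 by rewrite divr_gt0.
have [N _ uN] := ul _ e2_gt0; exists N => n Nn.
have := ltrD (uN n Nn) (uN N (leqnn N)); rewrite -splitr [`|l - _|]distrC /=.
move=> /(le_lt_trans (ler_normD _ _)); rewrite addrA subrK.
by rewrite (big_cat_nat (leq0n N) Nn) /= addrAC subrr add0r ger0_norm ?sumr_ge0.
Qed.

Lemma has_sum_series u : abs_summable u ->
  has_sum u (\big[+%R/0]_(0 <= i <oo) u i).
Proof.
move=> su e e_gt0; have e2_gt0 : 0 < e / 2 by rewrite divr_gt0.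
have /cvgrPdist_lt ul := complete su; have [N1 _ uN1] := ul _ e2_gt0.
have [N2 uN2] := abs_summable_tail su e2_gt0.
pose N := maxn N1 N2; exists (iota 0 N) => B uB NB.
have := uN1 N (leq_maxl _ _); rewrite /= => lt1.
rewrite (uniq_subset_sum u (iota_uniq 0 N) uB NB) opprD addrA.
apply: le_lt_trans (ler_normB _ _) _; rewrite (splitr e); apply: ltrD.
  by move: lt1; rewrite /index_iota subn0.
apply: le_lt_trans (ler_norm_sum _ _ _) _.
(* The successor of the sum of all elements of [B] is a strict upper bound of each of them. *)
have [M BM] : exists M, forall i, i \in B -> (i < M)%N.
  exists (\sum_(i <- B) i).+1 => i iB; rewrite ltnS (perm_big _ (perm_to_rem iB)) /=.
  by rewrite big_cons leq_addr.
have N2M : (N2 <= maxn M N2)%N := leq_maxr _ _.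
apply: le_lt_trans (uN2 _ N2M); rewrite -big_filter.
have sub : {subset [seq i <- B | i \notin iota 0 N] <= index_iota N2 (maxn M N2)}.
  move=> i; rewrite mem_filter mem_index_iota mem_iota /= add0n -leqNgt => /andP[Ni iB].
  by rewrite (leq_trans (leq_maxr _ _) Ni) (leq_trans (BM _ iB)) // leq_maxl.
rewrite (uniq_subset_sum _ (filter_uniq _ uB) (iota_uniq _ _) sub).
by rewrite lerDl sumr_ge0.
Qed.

Lemma has_sum_bilateral (t : int -> K) :
  abs_summable (fun n => t (Posz n)) -> abs_summable (fun n => t (Negz n)) ->
  has_sum t (bilateral_sum t).
Proof.
move=> st st'; pose h (x : nat + nat) := match x with inl n => Posz n | inr n => Negz n end.
pose h' n := match n with Posz n => inl n | Negz n => inr n end.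
apply: (@has_sum_reindex _ _ _ h h'); [by case|by case|].
by apply: has_sum_sum; apply: has_sum_series.
Qed.

Lemma has_sum_bilateral_norm (t : int -> K) :
  abs_summable (fun n => t (Posz n)) -> abs_summable (fun n => t (Negz n)) ->
  exists S, has_sum (fun n => `|t n|) S.
Proof.
move=> st st'; exists (bilateral_sum (fun n => `|t n|)).
by apply: has_sum_bilateral; apply: abs_summable_norm.
Qed.
End CompleteField.

(** * Infinite products and Tannery's theorem *)

Section InfiniteProducts.
Local Open Scope classical_set_scope.
Variable K : numFieldType.
Implicit Types u v : nat -> K.
Hypothesis complete : series_complete K.

Lemma abs_summable_cvg0 u : abs_summable u -> u @ \oo --> 0.
Proof.
move=> su; apply/cvgrPdist_lt => e e_gt0.
have [N uN] := abs_summable_tail complete su e_gt0; exists N => // n Nn.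
have Nn' : (N <= n)%N by [].
rewrite sub0r normrN; apply: le_lt_trans (uN n.+1 (leqW Nn')).
by rewrite big_nat_recr //= lerDr sumr_ge0.
Qed.

Lemma cvg_geometric0 (x : K) : `|x| < 1 -> (fun n => x ^+ n) @ \oo --> 0.
Proof. by move=> /abs_summable_geometric /abs_summable_cvg0. Qed.

(** The ratio of consecutive terms is [a * Q ^+ n], which tends to 0 whatever the size of a. *)
Lemma abs_summable_theta_Posz (a Q : K) : `|Q| < 1 ->
  abs_summable (fun n => a ^+ n * Q ^+ 'C(n, 2)).
Proof.
move=> Q_lt1; have : (fun n => a * Q ^+ n) @ \oo --> 0.
  by rewrite -(mulr0 a); apply: cvgM; [exact: cvg_cst|exact: cvg_geometric0].
move=> /cvgrPdist_lt /(_ (1 / 2) (divr_gt0 ltr01 (ltr0Sn _ 1))) [N _ aN].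
apply: (@abs_summable_ratio _ _ N) => n Nn.
have -> : a ^+ n.+1 * Q ^+ 'C(n.+1, 2) = (a ^+ n * Q ^+ 'C(n, 2)) * (a * Q ^+ n).
  by rewrite binS bin1 exprD exprS; ring.
rewrite normrM ler_wpM2l // ltW //; have := aN n Nn.
by rewrite /= sub0r normrN div1r.
Qed.

Lemma cvg_bounded u (l : K) : u @ \oo --> l -> exists B : K, forall n, `|u n| <= B.
Proof.
move=> /cvgrPdist_lt /(_ 1 ltr01) [N _ uN].
(* The sum of the first N norms stands in for their maximum. *)
exists (`|l| + 1 + \sum_(0 <= i < N) `|u i|) => n; case: (leqP N n) => Nn.
  have -> : u n = l - (l - u n) by rewrite opprB addrC subrK.
  apply: le_trans (ler_normB _ _) _; rewrite -addrA lerD2l.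
  by apply: ler_wpDr; [exact: sumr_ge0|apply: ltW; apply: uN].
rewrite ler_wpDl ?addr_ge0 //; rewrite (big_cat_nat (leq0n n) (ltnW Nn)) /=.
by rewrite ler_wpDl ?sumr_ge0 // big_ltn // lerDl sumr_ge0.
Qed.

(** Division-free form of the bound of a product of factors 1 + a by 1 / (1 - s), s being the sum of
    the a. The induction rests on (1 + a)(1 - s - a) <= 1 - s. *)
Lemma prod_1D_le (a : nat -> K) m n : (forall i, 0 <= a i) ->
  (\prod_(m <= i < n) (1 + a i)) * (1 - \sum_(m <= i < n) a i) <= 1.
Proof.
move=> a_ge0; case: (leqP n m) => [nm|/ltnW mn].
  by rewrite !big_geq // subr0 mul1r.
elim: n mn => [|n IHn]; first by rewrite leqn0 => /eqP ->; rewrite !big_geq // subr0 mul1r.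
rewrite leq_eqVlt => /predU1P[->|]; first by rewrite !big_geq // subr0 mul1r.
rewrite ltnS => mn; apply: le_trans (IHn mn); rewrite !big_nat_recr //=.
set P := \prod_(_ <= _ < _) _; set s := \sum_(_ <= _ < _) _.
have P_ge0 : 0 <= P by apply: prodr_ge0 => i _; rewrite addr_ge0.
have s_ge0 : 0 <= s by apply: sumr_ge0.
rewrite -mulrA ler_wpM2l // -subr_ge0.
have -> : 1 - s - (1 + a n) * (1 - (s + a n)) = a n * s + a n * a n by ring.
by rewrite addr_ge0 ?mulr_ge0.
Qed.

(** Once the tail of the norms is below 1/2, the preceding inequality bounds the remaining product
    by 2; the factors 1 + |u i| are at least 1, so short products are covered as well. *)
Lemma prod_1D_bounded u : abs_summable u ->
  exists B : K, forall n, `|\prod_(0 <= i < n) (1 + u i)| <= B.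
Proof.
move=> su; have half_gt0 : 0 < (1 : K) / 2 by rewrite divr_gt0.
have [N uN] := abs_summable_tail complete su half_gt0.
pose P m n := \prod_(m <= i < n) (1 + `|u i|).
have P_ge0 m n : 0 <= P m n by apply: prodr_ge0 => i _; rewrite addr_ge0.
have P_le2 n : (N <= n)%N -> P N n <= 2.
  move=> /uN s_lt; have := @prod_1D_le (fun i => `|u i|) N n (fun=> normr_ge0 _).
  rewrite -/(P N n); set s := \sum_(_ <= _ < _) _ in s_lt *; move=> Ps.
  rewrite -[leRHS]mul1r -ler_pdivrMr //; apply: le_trans Ps.
  rewrite ler_wpM2l // lerBrDr -lerBrDl; apply: le_trans (ltW s_lt) _.
  by have -> : (1 : K) - 2^-1 = 1 / 2 by field.
exists (P 0%N N * 2) => n; apply: (@le_trans _ _ (P 0%N n)).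
  by rewrite normr_prod; apply: ler_prod => i _; rewrite normr_ge0 (le_trans (ler_normD _ _)) ?normr1.
case: (leqP N n) => Nn.
  by rewrite {1}/P (big_cat_nat (leq0n N) Nn) /= ler_wpM2l //; [exact: P_ge0|exact: P_le2].
have P_ge1 m p : 1 <= P m p.
  rewrite /P; elim/big_ind: _ => // [x y x1 y1|i _]; last by rewrite lerDl.
  by rewrite -[leLHS]mulr1 ler_pM.
have -> : P 0%N N = P 0%N n * P n N := big_cat_nat (leq0n n) (ltnW Nn).
rewrite -mulrA ler_peMr ?P_ge0 //.
by rewrite -[leLHS]mulr1 ler_pM ?P_ge1 // ler1n.
Qed.

(** Consecutive partial products P differ by [P * u n], so the product telescopes into a series,
    absolutely summable because the P are bounded. *)
Lemma cvg_infinite_prod u : abs_summable u ->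
  cvgn (fun n => \prod_(0 <= i < n) (1 + u i)).
Proof.
move=> su; have [B PB] := prod_1D_bounded su.
have /complete := abs_summable_bounded_mul PB su.
have -> : (fun n => \prod_(0 <= i < n) (1 + u i)) = (fun n => 1 +
    \sum_(0 <= i < n) (\prod_(0 <= j < i) (1 + u j)) * u i).
  apply/funext; elim=> [|n IHn]; first by rewrite !big_geq // addr0.
  by rewrite !big_nat_recr //= IHn addrA -{1}IHn; rewrite IHn; ring.
by move=> cs; apply: is_cvgD => //; exact: is_cvg_cst.
Qed.

(** The inverse factors 1 / (1 + u) = 1 - u / (1 + u) also form a convergent product, and the two
    limits multiply to 1. *)
Lemma infinite_prod_neq0 u : abs_summable u -> (forall n, 1 + u n != 0) ->
  limn (fun n => \prod_(0 <= i < n) (1 + u i)) != 0.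
Proof.
move=> su u_neq0; apply/eqP.
have inv_cvg : (fun n => ((1 + u n)^-1)%R) @ \oo --> ((1 : K)^-1)%R.
  apply: cvgV; first exact: oner_neq0.
  rewrite -[X in _ --> X]addr0; apply: cvgD; first exact: cvg_cst.
  exact: abs_summable_cvg0.
have [B invB] := cvg_bounded inv_cvg.
have /(abs_summableZ (-1)) sv := abs_summable_bounded_mul invB su.
have Pu := cvg_infinite_prod su; have Pv := cvg_infinite_prod sv.
have := cvgM Pu Pv.
have -> : ((fun n => \prod_(0 <= i < n) (1 + u i)) \*
  (fun n => \prod_(0 <= i < n) (1 + -1 * ((1 + u i)^-1%R * u i)))) = (fun=> 1).
  apply/funext => n /=; rewrite -big_split /= big1 // => i _.
  by field; exact: u_neq0.
move=> PQ; have := cvg_unique (@norm_hausdorff _ _) (PQ _) (cvg_cst (1 : K)).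
by move=> /(_ _ _ _) + P0; rewrite P0 mul0r => /esym/eqP; rewrite oner_eq0.
Qed.

(** Replacing each coefficient by l leaves an error that is split at some M: the head is a fixed
    finite sum of null sequences, and the tail is at most B + |l| times a small tail of the norms of
    u. *)
Lemma tannery (c : nat -> nat -> K) (l B : K) u :
  abs_summable u -> (forall N n, `|c N n| <= B) ->
  (forall n, c^~ n @ \oo --> l) ->
  (fun N => \sum_(0 <= n < N) c N n * u n) @ \oo --> l * \big[+%R/0]_(0 <= n <oo) u n.
Proof.
move=> su cB cl; have B_ge0 : 0 <= B := le_trans (normr_ge0 _) (cB 0%N 0%N).
have -> : (fun N => \sum_(0 <= n < N) c N n * u n) =
  (fun N => l * \sum_(0 <= n < N) u n + \sum_(0 <= n < N) (c N n - l) * u n).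
  apply/funext => N; rewrite mulr_sumr -big_split /=.
  by apply: eq_bigr => n _; ring.
rewrite -[X in _ --> X]addr0; apply: cvgD.
  by apply: cvgM; [exact: cvg_cst|exact: complete].
apply/cvgrPdist_lt => e e_gt0; have e2_gt0 : 0 < e / 2 by rewrite divr_gt0.
have M_gt0 : 0 < B + `|l| + 1 by rewrite ltr_wpDl // addr_ge0.
set d := e / 2 / (B + `|l| + 1).
have d_gt0 : 0 < d by rewrite !divr_gt0.
have [M uM] := abs_summable_tail complete su d_gt0.
have : (fun N => \sum_(0 <= n < M) (c N n - l) * u n) @ \oo --> 0.
  elim: M {uM} => [|m IHm].
    have -> : (fun N => \sum_(0 <= n < 0) (c N n - l) * u n) = (fun=> 0).
      by apply/funext => N; rewrite big_geq.
    exact: cvg_cst.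
  have -> : (fun N => \sum_(0 <= n < m.+1) (c N n - l) * u n) =
      (fun N => \sum_(0 <= n < m) (c N n - l) * u n + (c N m - l) * u m).
    by apply/funext => N; rewrite big_nat_recr.
  rewrite -[X in _ --> X]addr0 -[X in _ + X](mul0r (u m)); apply: cvgD => //.
  apply: cvgM; last exact: cvg_cst.
  by rewrite -(subrr l); apply: cvgB; [exact: cl|exact: cvg_cst].
move=> /cvgrPdist_lt /(_ _ e2_gt0) [N1 _ N1P].
exists (maxn M N1) => // N; rewrite /= geq_max => /andP[MN N1N].
rewrite sub0r normrN (big_cat_nat (leq0n M) MN) /=.
apply: le_lt_trans (ler_normD _ _) _; rewrite (splitr e); apply: ltr_leD.
  by have := N1P N N1N; rewrite /= sub0r normrN.
apply: le_trans (ler_norm_sum _ _ _) _.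
apply: (@le_trans _ _ ((B + `|l| + 1) * \sum_(M <= n < N) `|u n|)).
  rewrite mulr_sumr ler_sum // => n _; rewrite normrM ler_wpM2r //.
  apply: le_trans (ler_normB _ _) _.
  by apply: ler_wpDr => //; rewrite lerD2r.
have := ltW (uM N MN); rewrite -(ler_pM2l M_gt0) => /le_trans; apply.
by rewrite /d mulrC divfK // gt_eqF.
Qed.
End InfiniteProducts.

(** * Jacobi's triple product identity *)

Lemma bin2S n : 'C(n.+1, 2) = ('C(n, 2) + n)%N.
Proof. by rewrite binS bin1. Qed.

Lemma bin2D m n : 'C(m + n, 2) = ('C(m, 2) + 'C(n, 2) + m * n)%N.
Proof. by elim: m => [|m IHm]; rewrite ?addn0 // addSn !bin2S IHm mulSn; lia. Qed.

Lemma bin2_mul2 n : ('C(n, 2) * 2 = n * n.-1)%N.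
Proof. by elim: n => // n IHn; rewrite bin2S; case: n IHn => //= n; nia. Qed.

(** * Gaussian binomial coefficients and the finite triple product *)

Section GaussianBinomials.
Variable K : comNzRingType.
Implicit Types Q a b x w : K.

(** Defined by the q-Pascal rule, hence without division. The truncated exponent is harmless: where
    it truncates, the coefficient it multiplies is 0. *)
Fixpoint gauss_bin Q M n : K :=
  match M, n with
  | _, 0 => 1
  | 0, _.+1 => 0
  | M'.+1, n'.+1 => gauss_bin Q M' n'.+1 + Q ^+ (M' - n') * gauss_bin Q M' n'
  end.

Lemma gauss_bin0 Q M : gauss_bin Q M 0 = 1.
Proof. by case: M. Qed.

Lemma gauss_bin_small Q M n : (M < n)%N -> gauss_bin Q M n = 0.
Proof.
elim: M n => [|M IHM] [|n] //= Mn.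
by rewrite !IHM ?mulr0 ?addr0 // ltnW.
Qed.

Lemma gauss_binn Q n : gauss_bin Q n n = 1.
Proof. by elim: n => //= n IHn; rewrite gauss_bin_small // IHn subnn add0r mul1r. Qed.

(** Induction on M: in the new factor, x produces the first Pascal term and [w * Q ^+ M] the second.
    The homogeneous variable x is there to be set to a power of Q. *)
Lemma gauss_binomial Q x w M :
  \prod_(0 <= j < M) (x + w * Q ^+ j) =
  \sum_(0 <= n < M.+1) gauss_bin Q M n * Q ^+ 'C(n, 2) * w ^+ n * x ^+ (M - n).
Proof.
elim: M => [|M IHM]; first by rewrite big_geq // big_nat1 !mulr1.
rewrite big_nat_recr //= IHM mulrDr [RHS]big_nat_recl //.
under [X in _ = _ + X]eq_big_nat => n /andP[_ nM].
  rewrite /= !mulrDl subSS; over.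
rewrite big_split /= addrA; congr (_ + _).
  rewrite [X in _ + X]big_nat_recr //= gauss_bin_small // !mul0r addr0.
  rewrite mulr_suml big_nat_recl //= gauss_bin0 !expr0 !subn0 !mul1r -exprSr.
  congr (_ + _); apply: eq_big_nat => n /andP[_ nM].
  by rewrite -mulrA -exprSr -subSn // subSS.
rewrite mulr_suml; apply: eq_big_nat => n /andP[_ nM].
have -> : Q ^+ M = Q ^+ (M - n) * Q ^+ n by rewrite -exprD subnK.
by rewrite bin2S exprD exprS; ring.
Qed.

Definition qpoch_fin (l Q : K) n : K := \prod_(0 <= j < n) (1 - l * Q ^+ j).

(** The closed quotient formula cleared of denominators. The Pascal rule reduces it to (1 - Q^(m+1))
    + Q^(m+1) (1 - Q^(n+1)) = 1 - Q^(n+m+2). *)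
Lemma gauss_bin_qpoch Q n m :
  gauss_bin Q (n + m) n * (qpoch_fin Q Q n * qpoch_fin Q Q m) = qpoch_fin Q Q (n + m).
Proof.
have qpochS p : qpoch_fin Q Q p.+1 = qpoch_fin Q Q p * (1 - Q * Q ^+ p).
  by rewrite /qpoch_fin big_nat_recr.
have qpoch0 : qpoch_fin Q Q 0 = 1 by rewrite /qpoch_fin big_geq.
elim: n m => [|n IHn] m; first by rewrite gauss_bin0 qpoch0 !mul1r.
elim: m => [|m IHm]; first by rewrite addn0 gauss_binn qpoch0 mul1r mulr1.
have IHn' := IHn m.+1.
rewrite !addSn /= mulrDl; have -> : (n + m.+1 - n = m.+1)%N by rewrite addKn.
have -> : gauss_bin Q (n + m.+1) n.+1 * (qpoch_fin Q Q n.+1 * qpoch_fin Q Q m.+1)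
   = qpoch_fin Q Q (n + m.+1) * (1 - Q * Q ^+ m).
  by rewrite addnS -addSn -IHm (qpochS m); ring.
by rewrite (qpochS n) (qpochS (n + m.+1)%N) -IHn' exprD !exprS; ring.
Qed.
End GaussianBinomials.

(* The Gauss binomial theorem for the 2 N factors Q^N + a Q^j, j < 2 N: since
   Q = a b, the first N of them are a Q^j (1 + b Q^(N - 1 - j)). *)
Lemma finite_triple_product (K : idomainType) (a b Q : K) N :
  a != 0 -> b != 0 -> Q = a * b ->
  \prod_(0 <= j < N) (1 + a * Q ^+ j) * \prod_(0 <= j < N) (1 + b * Q ^+ j) =
  \sum_(0 <= n < N.+1) gauss_bin Q (N + N) (N + n) * (a ^+ n * Q ^+ 'C(n, 2)) +
  \sum_(0 <= n < N) gauss_bin Q (N + N) (N - n.+1) * (b ^+ n.+1 * Q ^+ 'C(n.+1, 2)).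
Proof.
move=> a_neq0 b_neq0 QE; pose c := a ^+ N * Q ^+ ('C(N, 2) + N * N).
(* The factor c is what the 2 N factors contribute in common: a^N Q^C(N,2) from the lower half and
   Q^(N N) from the upper half. *)
have c_neq0 : c != 0 by rewrite mulf_neq0 ?expf_neq0 // QE mulf_neq0.
apply: (mulfI c_neq0).
have lowE : \prod_(0 <= j < N) (Q ^+ N + a * Q ^+ j) =
    a ^+ N * Q ^+ 'C(N, 2) * \prod_(0 <= j < N) (1 + b * Q ^+ j).
  rewrite [X in _ = _ * X]big_nat_rev /= add0n.
  have <- : \prod_(0 <= j < N) (a * Q ^+ j) = a ^+ N * Q ^+ 'C(N, 2).
    elim: (N) => [|n IHn]; first by rewrite big_geq // mulr1.
    by rewrite big_nat_recr //= IHn bin2S exprD exprS; ring.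
  rewrite -big_split /=; apply: eq_big_nat => j /andP[_ jN].
  have -> : Q ^+ N = Q ^+ j * Q ^+ (N - j.+1) * Q.
    by rewrite -exprD -exprSr; congr (_ ^+ _); lia.
  by rewrite [X in _ * X]QE; ring.
have highE : \prod_(N <= j < N + N) (Q ^+ N + a * Q ^+ j) =
    Q ^+ (N * N) * \prod_(0 <= j < N) (1 + a * Q ^+ j).
  rewrite -{1}[N]add0n big_addn addnK exprM.
  have <- : \prod_(0 <= j < N) Q ^+ N = (Q ^+ N) ^+ N by rewrite prodr_const_nat subn0.
  rewrite -big_split /=.
  by apply: eq_bigr => j _; rewrite exprD; ring.
have := gauss_binomial Q (Q ^+ N) a (N + N).
rewrite (big_cat_nat (leq0n N) (leq_addr N N)) /= lowE highE => prodE.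
transitivity (a ^+ N * Q ^+ 'C(N, 2) * \prod_(0 <= j < N) (1 + b * Q ^+ j) *
    (Q ^+ (N * N) * \prod_(0 <= j < N) (1 + a * Q ^+ j))).
  by rewrite /c exprD; ring.
(* Indices N + n give the powers of a. Indices p = N - n - 1, met in reverse order, give the powers
   of b through a^N b^(n+1) = a^p Q^(n+1). *)
rewrite prodE (big_cat_nat (leq0n N)) /=; last by rewrite ltnW // ltnS leq_addr.
rewrite addrC mulrDr; congr (_ + _).
  rewrite -{1}[N]add0n big_addn mulr_sumr -addSn addnK.
  apply: eq_big_nat => n /andP[_]; rewrite ltnS => nN; rewrite [(n + N)%N]addnC /c.
  have -> : a ^+ N * Q ^+ ('C(N, 2) + N * N) * (gauss_bin Q (N + N) (N + n) *
      (a ^+ n * Q ^+ 'C(n, 2))) = gauss_bin Q (N + N) (N + n) *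
      Q ^+ ('C(N, 2) + N * N + 'C(n, 2)) * a ^+ (N + n) by rewrite !exprD; ring.
  have -> : ('C(N, 2) + N * N + 'C(n, 2) = 'C(N + n, 2) + N * (N + N - (N + n)))%N.
    have : (N * (N + N - (N + n)) = N * N - N * n)%N by rewrite subnDl mulnBr.
    have : (N * n <= N * N)%N by rewrite leq_mul2l nN orbT.
    by rewrite bin2D; lia.
  by rewrite [Q ^+ (_ + _)]exprD [Q ^+ (N * _)]exprM; ring.
rewrite big_nat_rev /= add0n mulr_sumr; apply: eq_big_nat => n /andP[_ nN].
have [p Np] : exists p, N = (n.+1 + p)%N by exists (N - n.+1)%N; rewrite subnKC.
have -> : (N - n.+1 = p)%N by lia.
have -> : (N + N - p = N + n.+1)%N by lia.
have abE : a ^+ N * (b ^+ n.+1) = a ^+ p * Q ^+ n.+1.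
  by rewrite {1}Np QE exprMn exprD; ring.
transitivity (gauss_bin Q (N + N) p * Q ^+ ('C(N, 2) + N * N + 'C(n.+1, 2)) *
    (a ^+ N * b ^+ n.+1)); last by rewrite /c !exprD; ring.
transitivity (gauss_bin Q (N + N) p * Q ^+ ('C(p, 2) + N * (N + n.+1)) * a ^+ p).
  by rewrite [Q ^+ (_ + _)]exprD [Q ^+ (N * _)]exprM; ring.
have -> : ('C(p, 2) + N * (N + n.+1) = 'C(N, 2) + N * N + 'C(n.+1, 2) + n.+1)%N.
  by have := bin2_mul2 n.+1; rewrite Np bin2D /=; nia.
by rewrite abE exprD; ring.
Qed.

(** * The theta series and the limit of the finite triple product *)

Section ThetaProducts.
Local Open Scope classical_set_scope.
Variable K : numFieldType.
Implicit Types a b l q Q : K.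

Lemma theta_Posz a b n :
  a ^ ((Posz n * (Posz n + 1)) %/ 2)%Z * b ^ ((Posz n * (Posz n - 1)) %/ 2)%Z =
  a ^+ n * (a * b) ^+ 'C(n, 2).
Proof.
have -> : ((Posz n * (Posz n + 1)) %/ 2)%Z = Posz ('C(n, 2) + n)%N.
  rewrite -[RHS](@mulzK _ 2) //; congr (_ %/ _)%Z.
  by have := bin2_mul2 n; case: n => [|n] //=; lia.
have -> : ((Posz n * (Posz n - 1)) %/ 2)%Z = Posz 'C(n, 2).
  rewrite -[RHS](@mulzK _ 2) //; congr (_ %/ _)%Z.
  by have := bin2_mul2 n; case: n => [|n] //=; lia.
by rewrite -!exprnP exprD exprMn; ring.
Qed.

(** Changing the sign of the index exchanges the two exponents, so this is the nonnegative case at n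
    + 1 with a and b swapped. *)
Lemma theta_Negz a b n :
  a ^ ((Negz n * (Negz n + 1)) %/ 2)%Z * b ^ ((Negz n * (Negz n - 1)) %/ 2)%Z =
  b ^+ n.+1 * (a * b) ^+ 'C(n.+1, 2).
Proof.
rewrite mulrC [a * b]mulrC -theta_Posz NegzE.
congr (_ ^ (_ %/ _)%Z * _ ^ (_ %/ _)%Z); ring.
Qed.

Lemma thetaE a b : theta a b =
  \big[+%R/0]_(0 <= n <oo) (a ^+ n * (a * b) ^+ 'C(n, 2)) +
  \big[+%R/0]_(0 <= n <oo) (b ^+ n.+1 * (a * b) ^+ 'C(n.+1, 2)).
Proof.
rewrite /theta /bilateral_sum; congr (limn _ + limn _); apply/funext => n;
  apply: eq_bigr => i _; [exact: theta_Posz | exact: theta_Negz].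
Qed.

Hypothesis complete : series_complete K.

Lemma abs_summable_theta_Negz b Q : `|Q| < 1 ->
  abs_summable (fun n => b ^+ n.+1 * Q ^+ 'C(n.+1, 2)).
Proof.
move=> Q_lt1; have := abs_summableZ b (abs_summable_theta_Posz complete (b * Q) Q_lt1).
move=> [M uM]; exists M => n; apply: le_trans (uM n); rewrite le_eqVlt; apply/orP; left.
by apply/eqP/eq_bigr => i _; congr `|_|; rewrite bin2S exprD exprMn exprS; ring.
Qed.

Lemma abs_summable_qpoch l q : `|q| < 1 -> abs_summable (fun n => - (l * q ^+ n)).
Proof.
move=> q_lt1; have := abs_summableZ (- l) (abs_summable_geometric q_lt1).
by under eq_fun do rewrite mulNr.
Qed.

Lemma cvg_qpoch l q : `|q| < 1 -> qpoch_fin l q @ \oo --> qpoch l q.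
Proof. by move=> q_lt1; apply: cvg_infinite_prod complete _ (abs_summable_qpoch l q_lt1). Qed.

Lemma qpoch_neq0 l q : `|q| < 1 -> (forall n, l * q ^+ n != 1) -> qpoch l q != 0.
Proof.
move=> q_lt1 lq; apply: infinite_prod_neq0 complete _ (abs_summable_qpoch l q_lt1) _ => n.
by rewrite subr_eq0 eq_sym.
Qed.

(** The slack d allows for truncated differences such as N - n with n fixed. *)
Lemma cvg_reindex (u : nat -> K) (l : K) (f : nat -> nat) d :
  (forall n, (n <= f n + d)%N) -> u @ \oo --> l -> u \o f @ \oo --> l.
Proof.
move=> fd /cvgrPdist_lt ul; apply/cvgrPdist_lt => e /ul [N _ uN].
exists (N + d)%N => // n /= Nn; apply: uN => /=.
by rewrite -(leq_add2r d) (leq_trans Nn).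
Qed.

Lemma jacobi_triple_product a b : a != 0 -> b != 0 -> `|a * b| < 1 ->
  theta a b = qpoch (- a) (a * b) * qpoch (- b) (a * b) * qpoch (a * b) (a * b).
Proof.
move=> a_neq0 b_neq0; set Q := a * b => Q_lt1.
set L := qpoch Q Q.
have Qn_neq1 n : Q ^+ n.+1 != 1.
  apply/eqP => /(congr1 Num.norm); rewrite normrX normr1 => QE.
  by have := exprn_ilt1 n.+1 (normr_ge0 Q) Q_lt1; rewrite QE ltxx.
have L_neq0 : L != 0 by apply: qpoch_neq0 => // n; rewrite -exprS.
have fin_neq0 n : qpoch_fin Q Q n != 0.
  rewrite prodf_seq_neq0; apply/allP => i _ /=.
  by rewrite subr_eq0 eq_sym -exprS.
have cvgQ : qpoch_fin Q Q @ \oo --> L by apply: cvg_qpoch.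
have cvgQV : (fun n => (qpoch_fin Q Q n)^-1%R) @ \oo --> (L^-1)%R by apply: cvgV.
have [B QB] := cvg_bounded cvgQ; have [B' QB'] := cvg_bounded cvgQV.
have gaussE n m : gauss_bin Q (n + m) n =
    qpoch_fin Q Q (n + m) * ((qpoch_fin Q Q n)^-1%R * (qpoch_fin Q Q m)^-1%R).
  by rewrite -gauss_bin_qpoch -invfM mulfK // mulf_neq0.
have gauss_le n m : `|gauss_bin Q (n + m) n| <= B * (B' * B').
  by rewrite gaussE !normrM !ler_pM ?mulr_ge0.
have cvg_gauss (f g : nat -> nat) d :
    (forall N, (N <= f N + d)%N) -> (forall N, (N <= g N + d)%N) ->
    (fun N => gauss_bin Q (f N + g N) (f N)) @ \oo --> (L^-1)%R.
  move=> fd gd; have -> : (L^-1)%R = L * ((L^-1)%R * (L^-1)%R) by rewrite mulrA mulfV ?mul1r.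
  under eq_fun do rewrite gaussE; apply: cvgM.
    apply: (@cvg_reindex _ _ (fun N => f N + g N)%N d) => // n.
    by rewrite (leq_trans (fd n)) // leq_add2r leq_addr.
  by apply: cvgM; [exact: cvg_reindex fd cvgQV|exact: cvg_reindex gd cvgQV].
(* The upper arguments are written as sums so that the uniform bound holds for all N and n, even
   where subtraction truncates; in the range of summation they equal N + N. *)
pose c N n := gauss_bin Q ((N + n) + (N - n)) (N + n).
pose c' N n := gauss_bin Q ((N - n.+1) + (N + N - (N - n.+1))) (N - n.+1).
have /(tannery complete (abs_summable_theta_Posz complete a Q_lt1)) lim1 : forall N n, `|c N n| <= B * (B' * B').
  by move=> N n; exact: gauss_le.
have /(tannery complete (abs_summable_theta_Negz b Q_lt1)) lim2 : forall N n, `|c' N n| <= B * (B' * B').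
  by move=> N n; exact: gauss_le.
have {}lim1 := lim1 _ (fun n => cvg_gauss (fun N => N + n)%N (fun N => N - n)%N n _ _).
have {}lim2 := lim2 _ (fun n => cvg_gauss (fun N => N - n.+1)%N
  (fun N => N + N - (N - n.+1))%N n.+1 _ _).
(* The finite identity has N + 1 terms in its first sum, Tannery's theorem only N; the extra term
   has coefficient 1 and tends to 0. *)
have lim0 := abs_summable_cvg0 complete (abs_summable_theta_Posz complete a Q_lt1).
have prodE : (fun N => qpoch_fin (- a) Q N * qpoch_fin (- b) Q N) = (fun N =>
    (\sum_(0 <= n < N) c N n * (a ^+ n * Q ^+ 'C(n, 2)) + a ^+ N * Q ^+ 'C(N, 2)) +
    \sum_(0 <= n < N) c' N n * (b ^+ n.+1 * Q ^+ 'C(n.+1, 2))).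
  apply/funext => N; rewrite /qpoch_fin.
  under eq_bigr do rewrite mulNr opprK; under [X in _ * X]eq_bigr do rewrite mulNr opprK.
  rewrite (@finite_triple_product _ a b Q) //; congr (_ + _).
    rewrite big_nat_recr //= gauss_binn mul1r; congr (_ + _).
    apply: eq_big_nat => n /andP[_ nN]; rewrite /c; congr (gauss_bin _ _ _ * _); lia.
  by apply: eq_big_nat => n /andP[_ nN]; rewrite /c' subnKC //; lia.
have {}lim1 : _ := lim1 ltac:(lia) ltac:(lia).
have {}lim2 : _ := lim2 ltac:(lia) ltac:(lia).
have prod_cvg : (fun N => qpoch_fin (- a) Q N * qpoch_fin (- b) Q N) @ \oo -->
    qpoch (- a) Q * qpoch (- b) Q by apply: cvgM; exact: cvg_qpoch.
rewrite thetaE -/Q; set A := limn _ in lim1 *; set A' := limn _ in lim2 *.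
have sum_cvg : (fun N => qpoch_fin (- a) Q N * qpoch_fin (- b) Q N) @ \oo -->
    L^-1%R * A + 0 + L^-1%R * A'.
  by rewrite prodE; apply: cvgD lim2; apply: cvgD lim1 lim0.
rewrite (cvg_unique (@norm_hausdorff _ _) prod_cvg sum_cvg) addr0 -mulrDr.
by rewrite mulrC mulrA mulfV ?mul1r.
Qed.
End ThetaProducts.

(** * Theta function identities *)

Section QPochIdentities.
Local Open Scope classical_set_scope.
Variable K : numFieldType.
Implicit Types l q x : K.
Hypothesis complete : series_complete K.

(** Even and odd indices are separated in the partial products of length 2 n. *)
Lemma qpoch_split l q : `|q| < 1 ->
  qpoch l q = qpoch l (q ^+ 2) * qpoch (l * q) (q ^+ 2).
Proof.
move=> q_lt1; have q2_lt1 : `|q ^+ 2| < 1 by rewrite normrX exprn_ilt1.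
have lim1 : qpoch_fin l q \o (fun n => n + n)%N @ \oo --> qpoch l q.
  apply: (@cvg_reindex _ _ _ _ 0 _ (cvg_qpoch complete q_lt1)) => n; lia.
have lim2 : (fun n => qpoch_fin l (q ^+ 2) n * qpoch_fin (l * q) (q ^+ 2) n) @ \oo -->
    qpoch l (q ^+ 2) * qpoch (l * q) (q ^+ 2) by apply: cvgM; exact: cvg_qpoch.
have finE : qpoch_fin l q \o (fun n => n + n)%N =
    (fun n => qpoch_fin l (q ^+ 2) n * qpoch_fin (l * q) (q ^+ 2) n).
  apply/funext; elim=> [|n IHn]; first by rewrite /= /qpoch_fin !big_geq ?mulr1.
  move: IHn; rewrite /= /qpoch_fin addnS addSn !big_nat_recr //= => ->.
  rewrite -!exprM mul2n -addnn [q ^+ (n + n).+1]exprS; ring.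
rewrite finE in lim1; exact: (cvg_unique (@norm_hausdorff _ _) lim1 lim2).
Qed.

Lemma qpoch_mulN l q : `|q| < 1 ->
  qpoch l q * qpoch (- l) q = qpoch (l ^+ 2) (q ^+ 2).
Proof.
move=> q_lt1; have q2_lt1 : `|q ^+ 2| < 1 by rewrite normrX exprn_ilt1.
have lim1 := @cvg_qpoch _ complete (l ^+ 2) _ q2_lt1.
have lim2 : (fun n => qpoch_fin l q n * qpoch_fin (- l) q n) @ \oo -->
    qpoch l q * qpoch (- l) q by apply: cvgM; exact: cvg_qpoch.
have finE : qpoch_fin (l ^+ 2) (q ^+ 2) = (fun n => qpoch_fin l q n * qpoch_fin (- l) q n).
  apply/funext => n; rewrite /qpoch_fin -big_split; apply: eq_bigr => i _ /=.
  by rewrite exprAC; ring.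
rewrite finE in lim1; exact: (cvg_unique (@norm_hausdorff _ _) lim2 lim1).
Qed.

(** Gauss's product for psi without denominators. The triple product gives psi(x) = (-x; x^2) (x^4;
    x^4); then (x; x) = (x; x^2) (x^2; x^2), (x; x^2) (-x; x^2) = (x^2; x^4) and (x^2; x^4) (x^4;
    x^4) = (x^2; x^2). *)
Lemma psi_mul_qpoch x : x != 0 -> `|x| < 1 ->
  psi x * qpoch x x = qpoch (x ^+ 2) (x ^+ 2) ^+ 2.
Proof.
move=> x_neq0 x_lt1; have xX_lt1 n : `|x ^+ n.+1| < 1 by rewrite normrX exprn_ilt1.
rewrite /psi (jacobi_triple_product complete) ?expf_neq0 //; last by rewrite -exprS.
rewrite -exprS (qpoch_split x x_lt1).
have /(_ (- x)) : forall l, qpoch l (x ^+ 2) = qpoch l (x ^+ 4) * qpoch (l * x ^+ 2) (x ^+ 4).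
  by move=> l; rewrite (qpoch_split l (xX_lt1 1%N)) -exprM.
rewrite mulNr -exprS => <-.
have -> : qpoch (- x) (x ^+ 2) * qpoch (x ^+ 4) (x ^+ 4) *
    (qpoch x (x ^+ 2) * qpoch (x * x) (x ^+ 2)) =
    (qpoch x (x ^+ 2) * qpoch (- x) (x ^+ 2)) * qpoch (x ^+ 4) (x ^+ 4) *
    qpoch (x ^+ 2) (x ^+ 2) by rewrite expr2; ring.
by rewrite qpoch_mulN // (qpoch_split (x ^+ 2) (xX_lt1 1%N)) -!exprM -exprD.
Qed.
End QPochIdentities.

(** * Dissection of the difference of theta squares *)

Section ThetaIdentities.
Variable K : numFieldType.
Implicit Types a b c e x y : K.
Hypothesis complete : series_complete K.

Lemma has_sum_theta a b : `|a * b| < 1 ->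
  let t (n : int) := a ^ ((n * (n + 1)) %/ 2)%Z * b ^ ((n * (n - 1)) %/ 2)%Z in
  has_sum t (theta a b) /\ exists S, has_sum (fun n => `|t n|) S.
Proof.
move=> ab_lt1 t.
have st : abs_summable (fun n => t (Posz n)).
  under eq_fun do rewrite /t theta_Posz; exact: abs_summable_theta_Posz.
have st' : abs_summable (fun n => t (Negz n)).
  under eq_fun do rewrite /t theta_Negz; exact: abs_summable_theta_Negz.
by split; [exact: has_sum_bilateral|exact: has_sum_bilateral_norm].
Qed.

Lemma expfz_sqr1 c (n m : int) : c ^+ 2 = 1 -> c ^ (n + 2 * m) = c ^ n.
Proof.
move=> c2; have c_neq0 : c != 0.
  by apply/eqP => c0; move/eqP: c2; rewrite c0 expr0n /= eq_sym oner_eq0.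
by rewrite expfzDr // -exprz_exp -exprnP c2 exp1rz mulr1.
Qed.

(** Since p + r is even, the halved exponents combine into an integral polynomial in n, so later
    comparisons of exponents are ring identities. The sign c enters with total exponent congruent to
    n modulo 2. *)
Lemma theta_term_monomial c x y (p r s n : int) :
  c ^+ 2 = 1 -> x != 0 -> y != 0 -> p + r = 2 * s ->
  (c * x ^ p * y) ^ ((n * (n + 1)) %/ 2)%Z * (c * x ^ r / y) ^ ((n * (n - 1)) %/ 2)%Z
  = c ^ n * x ^ (s * (n * (n - 1)) + p * n) * y ^ n.
Proof.
move=> c2 x_neq0 y_neq0 prE; have c_neq0 : c != 0.
  by apply/eqP => c0; move/eqP: c2; rewrite c0 expr0n /= eq_sym oner_eq0.
set T := ((n * (n - 1)) %/ 2)%Z; set T' := ((n * (n + 1)) %/ 2)%Z.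
have [k nE] : exists k, n * (n - 1) = k * 2.
  have [m [nE|nE]] : exists m, n = 2 * m \/ n = 2 * m + 1 by exists (n %/ 2)%Z; lia.
    by exists (m * (2 * m - 1)); rewrite nE; ring.
  by exists ((2 * m + 1) * m); rewrite nE; ring.
have TE : T = k by rewrite /T nE mulzK.
have T'E : T' = T + n.
  rewrite TE /T'; have -> : n * (n + 1) = (k + n) * 2 by rewrite mulrDl -nE; ring.
  by rewrite mulzK.
rewrite T'E !exprzMl ?unitfE ?mulf_neq0 ?expfz_neq0 ?invr_neq0 //.
have -> : c ^ n = c ^ (T + n) * c ^ T.
  by rewrite -expfzDr // -(expfz_sqr1 n T c2); congr (_ ^ _); ring.
have -> : (y^-1 ^ T = (y ^ T)^-1)%R by rewrite exprz_inv invr_expz.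
have -> : s * (n * (n - 1)) + p * n = (p + r) * T + p * n by rewrite prE nE TE; ring.
have -> : x ^ ((p + r) * T + p * n) = (x ^ p) ^ (T + n) * (x ^ r) ^ T.
  by rewrite !exprz_exp -expfzDr //; congr (_ ^ _); ring.
have -> : y ^ n = y ^ (T + n) * (y ^ T)^-1%R.
  by rewrite expfzDr // mulrAC mulfV ?mul1r // expfz_neq0.
ring.
Qed.

(* The pairs (n - m, n + m) are those with coordinates of equal parity, and the
   pairs (n - m, 1 - (n + m)) those with coordinates of opposite parity. *)
Lemma theta_sqr_dissection e x y :
  e ^+ 2 = 1 -> x != 0 -> y != 0 -> `|x| < 1 ->
  theta (- (x * y)) (- (x ^+ 3 / y)) ^+ 2 -
    e * y * theta (- (x / y)) (- (x ^+ 3 * y)) ^+ 2 =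
  phi (e * x) * theta (- (e * y)) (- (e * (x ^+ 2 / y))).
Proof.
move=> e2 x_neq0 y_neq0 x_lt1.
have xX_lt1 n : `|x ^+ n.+1| < 1 by rewrite normrX exprn_ilt1.
have yV_neq0 : (y^-1 != 0)%R by rewrite invr_neq0.
have e_neq0 : e != 0.
  by apply/eqP => e0; move/eqP: e2; rewrite e0 expr0n /= eq_sym oner_eq0.
have [] := @has_sum_theta (- (x * y)) (- (x ^+ 3 / y)).
  have -> : - (x * y) * - (x ^+ 3 / y) = x ^+ 4 by field.
  exact: xX_lt1.
set t1 := fun n : int => _ => /= sum1 [S1 norm1].
have [] := @has_sum_theta (- (x / y)) (- (x ^+ 3 * y)).
  have -> : - (x / y) * - (x ^+ 3 * y) = x ^+ 4 by field.
  exact: xX_lt1.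
set t2 := fun n : int => _ => /= sum2 [S2 norm2].
have [] := @has_sum_theta (e * x) (e * x).
  have -> : e * x * (e * x) = e ^+ 2 * x ^+ 2 by ring.
  by rewrite e2 mul1r; exact: xX_lt1.
set t3 := fun n : int => _ => /= sum3 [S3 norm3].
have [] := @has_sum_theta (- (e * y)) (- (e * (x ^+ 2 / y))).
  have -> : - (e * y) * - (e * (x ^+ 2 / y)) = e ^+ 2 * x ^+ 2 by field.
  by rewrite e2 mul1r; exact: xX_lt1.
set t4 := fun n : int => _ => /= sum4 [S4 norm4].
have t1E n : t1 n = (- 1) ^ n * x ^ (2 * (n * (n - 1)) + 1 * n) * y ^ n.
  rewrite -(@theta_term_monomial _ _ _ 1 3) ?sqrrN ?expr1n // /t1.
  by congr (_ ^ _ * _ ^ _); rewrite -?exprnP; ring.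
have t2E n : t2 n = (- 1) ^ n * x ^ (2 * (n * (n - 1)) + 1 * n) * (y^-1 ^ n)%R.
  rewrite -(@theta_term_monomial _ _ _ 1 3) ?sqrrN ?expr1n // /t2.
  by congr (_ ^ _ * _ ^ _); rewrite ?invrK -?exprnP; ring.
have t3E n : t3 n = e ^ n * x ^ (1 * (n * (n - 1)) + 1 * n).
  rewrite -[RHS]mulr1 -[X in _ * X](exp1rz K n).
  rewrite -(@theta_term_monomial _ _ _ 1 1) ?oner_neq0 // /t3.
  by congr (_ ^ _ * _ ^ _); rewrite ?invr1 -?exprnP; ring.
have t4E n : t4 n = (- e) ^ n * x ^ (1 * (n * (n - 1)) + 0 * n) * y ^ n.
  rewrite -(@theta_term_monomial _ _ _ 0 2) ?sqrrN // /t4.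
  by congr (_ ^ _ * _ ^ _); rewrite -?exprnP; ring.
(* In a pair (v, u), v indexes the series of phi and u that of the other theta function; the parity
   of u + v tells which square the pair comes from. *)
pose h (z : (int * int) + (int * int)) : int * int :=
  match z with inl (n, m) => (n - m, n + m) | inr (n, m) => (n - m, 1 - (n + m)) end.
pose h' (z : int * int) : (int * int) + (int * int) := let: (v, u) := z in
  if ((u + v) %% 2)%Z == 0 then inl (((u + v) %/ 2)%Z, ((u - v) %/ 2)%Z)
  else inr (((1 - u + v) %/ 2)%Z, ((1 - u - v) %/ 2)%Z).
have hK : cancel h h'.
  move=> [[n m]|[n m]] /=; [rewrite ifT; last lia|rewrite ifF; last lia].
    by congr (inl (_, _)); lia.
  by congr (inr (_, _)); lia.
have h'K : cancel h' h.
  by move=> [v u]; rewrite /h'; case: ifP => parity /=; congr (_, _); lia.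
have regroup (s u w s' u' w' : K) :
    s * u * w * (s' * u' * w') = (s * s') * (u * u') * (w * w') by ring.
have rhs_sum := has_sum_mul sum3 sum4 norm3 norm4.
apply: has_sum_unique rhs_sum; apply: (has_sum_reindex hK h'K).
have lhs1 := has_sum_mul sum1 sum1 norm1 norm1.
have lhs2 := has_sumZ (- (e * y)) (has_sum_mul sum2 sum2 norm2 norm2).
rewrite ![theta _ _ ^+ 2]expr2 -[- (e * y * _)]mulNr.
apply: (@has_sum_sum _ _ _ (_ \o h)).
  apply: (eq_has_sum _ lhs1) => -[n m] /=; rewrite !(t1E, t3E, t4E).
  have signE : e ^ (n - m) * (- e) ^ (n + m) = (- 1) ^ n * (- 1) ^ m.
    rewrite -[- e]mulN1r exprzMl ?unitrN1 ?unitfE // mulrCA -expfzDr //.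
    have -> : n - m + (n + m) = 0 + 2 * n by ring.
    by rewrite expfz_sqr1 // mulr1 expfzDr.
  (* With v = n - m and u = n + m, both exponents are 2 n^2 - n + 2 m^2 - m = v^2 + u (u - 1). *)
  have xE : x ^ (2 * (n * (n - 1)) + 1 * n) * x ^ (2 * (m * (m - 1)) + 1 * m) =
      x ^ (1 * ((n - m) * (n - m - 1)) + 1 * (n - m)) *
      x ^ (1 * ((n + m) * (n + m - 1)) + 0 * (n + m)).
    by rewrite -!expfzDr //; congr (_ ^ _); ring.
  by rewrite regroup xE -signE [y ^ (n + m)]expfzDr //; ring.
apply: (eq_has_sum _ lhs2) => -[n m] /=; rewrite !(t2E, t3E, t4E).
have signE : e ^ (n - m) * (- e) ^ (1 - (n + m)) = - e * ((- 1) ^ n * (- 1) ^ m).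
  rewrite -[X in X ^ (1 - _)]mulN1r exprzMl ?unitrN1 ?unitfE // mulrCA -expfzDr //.
  have -> : n - m + (1 - (n + m)) = 1 + 2 * (- m) by ring.
  rewrite -(@expfz_sqr1 _ (1 - (n + m)) (n + m)) ?sqrrN ?expr1n //.
  have -> : 1 - (n + m) + 2 * (n + m) = 1 + (n + m) by ring.
  by rewrite expfz_sqr1 // !expfzDr ?unitrN1 // !expr1z; ring.
(* The quantity u (u - 1) is invariant under the exchange of u and 1 - u, so the exponent of x is
   the same as for the first square. The prefactor - e y supplies the missing sign and the missing
   power of y. *)
have xE : x ^ (2 * (n * (n - 1)) + 1 * n) * x ^ (2 * (m * (m - 1)) + 1 * m) =
    x ^ (1 * ((n - m) * (n - m - 1)) + 1 * (n - m)) *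
    x ^ (1 * ((1 - (n + m)) * (1 - (n + m) - 1)) + 0 * (1 - (n + m))).
  by rewrite -!expfzDr //; congr (_ ^ _); ring.
have yE : y * (y^-1 ^ n * y^-1 ^ m)%R = y ^ (1 - (n + m)).
  by rewrite expfzDr // expr1z -expfzDr // exprz_inv.
rewrite regroup xE -yE.
transitivity (- e * ((-1) ^ n * (-1) ^ m) * (x ^ (1 * ((n - m) * (n - m - 1)) + 1 * (n - m)) *
    x ^ (1 * ((1 - (n + m)) * (1 - (n + m) - 1)) + 0 * (1 - (n + m)))) *
    (y * (y^-1 ^ n * y^-1 ^ m)%R)); first by ring.
by rewrite -signE; ring.
Qed.
End ThetaIdentities.

(** * The identities for the quotient in the variables x, y, s *)

Section QuotientIdentities.
Variable K : numFieldType.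
Hypothesis complete : series_complete K.
Variables x y s : K.
Hypotheses (x_neq0 : x != 0) (x_lt1 : `|x| < 1) (s_neq0 : s != 0) (yE : y = s ^+ 2).

Let N := qpoch (x / y) (x ^+ 4) * qpoch (x ^+ 3 * y) (x ^+ 4).
Let D := qpoch (x * y) (x ^+ 4) * qpoch (x ^+ 3 / y) (x ^+ 4).
Let P n := qpoch (x ^+ n) (x ^+ n).

Let y_neq0 : y != 0. Proof. by rewrite yE expf_neq0. Qed.

Let xX_lt1 n : `|x ^+ n.+1| < 1. Proof. by rewrite normrX exprn_ilt1. Qed.

Lemma theta_quotient_num : theta (- (x / y)) (- (x ^+ 3 * y)) = N * P 4.
Proof.
have abE : - (x / y) * - (x ^+ 3 * y) = x ^+ 4 by field.
rewrite (jacobi_triple_product complete) ?abE ?oppr_eq0 ?mulf_neq0 ?invr_neq0 ?expf_neq0 //.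
by rewrite !opprK.
Qed.

Lemma theta_quotient_den : theta (- (x * y)) (- (x ^+ 3 / y)) = D * P 4.
Proof.
have abE : - (x * y) * - (x ^+ 3 / y) = x ^+ 4 by field.
rewrite (jacobi_triple_product complete) ?abE ?oppr_eq0 ?mulf_neq0 ?invr_neq0 ?expf_neq0 //.
by rewrite !opprK.
Qed.

(** Splitting the two products of base x^2 into base x^4 yields exactly the four factors of N and
    D. *)
Lemma theta_quotient_mid : theta (- (x / y)) (- (x * y)) = N * D * P 2.
Proof.
have abE : - (x / y) * - (x * y) = x ^+ 2 by field.
rewrite (jacobi_triple_product complete) ?abE ?oppr_eq0 ?mulf_neq0 ?invr_neq0 //.
rewrite !opprK (qpoch_split complete (x / y) (xX_lt1 1%N)).
rewrite (qpoch_split complete (x * y) (xX_lt1 1%N)) -exprM.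
have -> : x / y * x ^+ 2 = x ^+ 3 / y by ring.
have -> : x * y * x ^+ 2 = x ^+ 3 * y by ring.
by rewrite /N /D /P; ring.
Qed.

Lemma qpoch_self_neq0 n : P n.+1 != 0.
Proof.
apply: (qpoch_neq0 complete) => // i; rewrite -exprS -exprM mulSn addSn.
by apply/eqP => E; have := xX_lt1 (i + n * i.+1)%N; rewrite E normr1 ltxx.
Qed.

Lemma psi_mul_qpoch_sqr : psi (x ^+ 2) * P 2 = P 4 ^+ 2.
Proof. by rewrite /P psi_mul_qpoch ?expf_neq0 // -!exprM. Qed.

Hypotheses (N_neq0 : N != 0) (D_neq0 : D != 0).

Lemma quotient_theta :
  N / D = theta (- (x / y)) (- (x ^+ 3 * y)) / theta (- (x * y)) (- (x ^+ 3 / y)).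
Proof. by rewrite theta_quotient_num theta_quotient_den -[RHS]mulf_div divff ?mulr1 // qpoch_self_neq0. Qed.

(** The sign e treats both identities at once: e = 1 gives the difference and e = -1 the sum. After
    the dissection everything is a product of N, D, P 4 and s, and the factor P 4 squared cancels
    through psi. *)
Lemma quotient_identity e : e ^+ 2 = 1 ->
  1 / (s * (N / D)) - e * (s * (N / D)) =
  phi (e * x) * theta (- (e * y)) (- (e * (x ^+ 2 / y))) /
  (s * psi (x ^+ 2) * theta (- (x / y)) (- (x * y))).
Proof.
move=> e2; rewrite -(theta_sqr_dissection complete e2) // theta_quotient_num theta_quotient_den theta_quotient_mid.
have -> : s * psi (x ^+ 2) * (N * D * P 2) = s * (psi (x ^+ 2) * P 2) * (N * D) by ring.
have P4 := qpoch_self_neq0 3; rewrite psi_mul_qpoch_sqr yE; field.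
by rewrite N_neq0 D_neq0 P4 s_neq0.
Qed.
End QuotientIdentities.

(** * Specialisation to powers of the chosen fourth root *)

Lemma qpowE (K : numFieldType) (r : K) (e : rat) (z : int) :
  4 * e = z%:~R -> qpow r e = r ^ z.
Proof. by rewrite /qpow => ->; rewrite intrKfloor. Qed.

Theorem theorem1p1 (R : realType) (k m : nat) (i : rat) (q q4 : R[i])
    (k_gt0 : (0 < k)%N) (k_even : ~~ odd k)
    (m_ge1 : (1 <= m)%N) (i_def : i = m%:R / 2)
    (q_bounds : 0 < `|q| < 1) (q4_root : q4 ^+ 4 = q)
    (num_neq0 : S_num q4 k i != 0) (den_neq0 : S_den q4 k i != 0) :
  [/\ Sn q4 k i =
        qpow q4 (2 * i - 1) *
        (theta (- qpow q4 (k%:R / 4 - (4 * i - 2)))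
               (- qpow q4 (3 * k%:R / 4 + (4 * i - 2))) /
         theta (- qpow q4 (k%:R / 4 + (4 * i - 2)))
               (- qpow q4 (3 * k%:R / 4 - (4 * i - 2)))),
      1 / Sn q4 k i - Sn q4 k i =
        (phi (qpow q4 (k%:R / 4)) *
         theta (- qpow q4 (4 * i - 2))
               (- qpow q4 (k%:R / 2 - (4 * i - 2)))) /
        (qpow q4 (2 * i - 1) * psi (qpow q4 (k%:R / 2)) *
         theta (- qpow q4 (k%:R / 4 - (4 * i - 2)))
               (- qpow q4 (k%:R / 4 + (4 * i - 2))))
    & 1 / Sn q4 k i + Sn q4 k i =
        (phi (- qpow q4 (k%:R / 4)) *
         theta (qpow q4 (4 * i - 2))
               (qpow q4 (k%:R / 2 - (4 * i - 2)))) /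
        (qpow q4 (2 * i - 1) * psi (qpow q4 (k%:R / 2)) *
         theta (- qpow q4 (k%:R / 4 - (4 * i - 2)))
               (- qpow q4 (k%:R / 4 + (4 * i - 2))))].
Proof.
have q4_neq0 : q4 != 0.
  by apply/eqP => q0; move: q_bounds; rewrite -q4_root q0 expr0n /= normr0 ltxx.
have q4_lt1 : `|q4| < 1.
  rewrite real_ltNge ?normr_real ?real1 //; apply/negP => q4_ge1.
  by case/andP: q_bounds => _; rewrite -q4_root normrX le_gtF // exprn_ege1.
(* As i = m / 2, the exponents 2 i - 1 = m - 1 and 4 i - 2 = 2 (m - 1) are natural numbers; the
   factor 4 passes from q to its fourth root. *)
pose x := q4 ^+ k; pose s := q4 ^+ (4 * m.-1); pose y := s ^+ 2.
have x_neq0 : x != 0 by rewrite expf_neq0.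
have s_neq0 : s != 0 by rewrite expf_neq0.
have x_lt1 : `|x| < 1 by rewrite normrX exprn_ilt1 // -lt0n.
have mE : (m%:R : rat) = m.-1%:R + 1 by rewrite -[1]/(1%:R) -natrD addn1 prednK.
(* Apart from 2 i - 1, every exponent in the statement has the form n k / 4 + z (4 i - 2), and the
   hypothesis is this form multiplied by 4. *)
have qpowZ e (n : nat) (z : int) : 4 * e = n%:R * k%:R + z%:~R * 8 * m.-1%:R ->
    qpow q4 e = x ^+ n * y ^ z.
  move=> eE; have -> : qpow q4 e = q4 ^ (Posz (k * n) + Posz (4 * m.-1 * 2) * z).
    apply: qpowE; rewrite eE rmorphD rmorphM /= -!pmulrn !natrM; ring.
  by rewrite expfzDr // -exprz_exp -!exprnP /y /s !exprM.
have powE : [/\ qpow q4 (k%:R / 4 - (4 * i - 2)) = x / y,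
    qpow q4 (3 * k%:R / 4 + (4 * i - 2)) = x ^+ 3 * y,
    qpow q4 (k%:R / 4 + (4 * i - 2)) = x * y,
    qpow q4 (3 * k%:R / 4 - (4 * i - 2)) = x ^+ 3 / y &
    qpow q4 k%:R = x ^+ 4].
  split.
  - by rewrite (qpowZ _ 1 (-1)) ?exprN1 //; rewrite i_def mE; field.
  - by rewrite (qpowZ _ 3 1) ?expr1z //; rewrite i_def mE; field.
  - by rewrite (qpowZ _ 1 1) ?expr1z //; rewrite i_def mE; field.
  - by rewrite (qpowZ _ 3 (-1)) ?exprN1 //; rewrite i_def mE; field.
  - by rewrite (qpowZ _ 4 0) ?expr0z ?mulr1 //; field.
have powE' : [/\ qpow q4 (k%:R / 4) = x, qpow q4 (k%:R / 2) = x ^+ 2,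
    qpow q4 (4 * i - 2) = y, qpow q4 (k%:R / 2 - (4 * i - 2)) = x ^+ 2 / y &
    qpow q4 (2 * i - 1) = s].
  split.
  - by rewrite (qpowZ _ 1 0) ?expr0z ?mulr1 //; field.
  - by rewrite (qpowZ _ 2 0) ?expr0z ?mulr1 //; field.
  - by rewrite (qpowZ _ 0 1) ?expr1z ?mul1r //; rewrite i_def mE; field.
  - by rewrite (qpowZ _ 2 (-1)) ?exprN1 //; rewrite i_def mE; field.
  - rewrite (@qpowE _ _ _ (Posz (4 * m.-1))) -?exprnP //.
    by rewrite i_def mE -pmulrn natrM; field.
case: powE => p1 p2 p3 p4 p5; case: powE' => p6 p7 p8 p9 p10.
move: num_neq0 den_neq0; rewrite /Sn /S_num /S_den p1 p2 p3 p4 p5 p6 p7 p8 p9 p10.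
rewrite /qpochs !big_cons big_nil !mulr1 => N_neq0 D_neq0.
have complete := @complex_series_complete R.
have main := quotient_identity complete x_neq0 x_lt1 s_neq0 (erefl y) N_neq0 D_neq0.
split.
- by rewrite -(quotient_theta complete x_neq0 x_lt1 s_neq0 (erefl y)).
- by have := main 1 (expr1n _ _); rewrite !mul1r.
- by have := main (-1); rewrite sqrrN expr1n !mulN1r !opprK => /(_ erefl).
Qed.
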